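(* Let $n=4k+3$ be a positive integer ($k\ge 0$ an integer) and let $p=\beta(Q_{n\times n})=(n-1)/2=2k+1$. Let rows $(R_i)_{i=0}^{p-1}$, columns $(C_i)_{i=0}^{p-1}$, sum diagonals $(S_i)_{i=0}^{p-1}$ and difference diagonals $(D_i)_{i=0}^{p-1}$ of the $n\times n$ board (collectively, the $4p$ chosen lines) constitute a solution to the Relaxed Queen's Domination Problem for the $n\times n$ board, i.e. their union is the whole board. Let $l$ and $r$ be the leftmost and rightmost columns not among the $C_i$, let $b$ and $t$ be the bottommost and topmost rows not among the $R_i$, and let $U$ be the sub-board bounded by them, i.e. the set of cells $(x,y)$ with $l\le x\le r$ and $b\le y\le t$. Then: (a) The rows $(R_i)_{i=0}^{p-1}$ are all distinct; similarly, the columns $(C_i)_{i=0}^{p-1}$ are all distinct, the sum diagonals $(S_i)_{i=0}^{p-1}$ are all distinct, and the difference diagonals $(D_i)_{i=0}^{p-1}$ are all distinct. (b) $U$ is a square sub-board (that is, $r-l=t-b$). (c) Each edge square of $U$ is covered by exactly one of the $4p$ chosen lines. (d) Each chosen diagonal (sum or difference) intersects the edge cells of $U$ in two cells. (e) The sum diagonal joining the top-left corner $(l,t)$ and the bottom-right corner $(r,b)$ of $U$ is chosen; of the remaining $2k$ chosen sum diagonals, half are above it and half are below it. Analogously, the difference diagonal joining the bottom-left corner $(l,b)$ and the top-right corner $(r,t)$ of $U$ is chosen; of the remaining $2k$ chosen difference diagonals, half are above it and half are below it.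
   Context: The squares (cells) of the $n\times n$ chessboard are $V(Q_{n\times n})=\{(x,y): 0\le x,y\le n-1\}$, with $x$ the column number (increasing left to right) and $y$ the row number (increasing bottom to top). A column is a set of all cells with a fixed $x$; a row is a set of all cells with a fixed $y$; columns and rows are identified with their numbers. A sum diagonal is a (nonempty) set of all cells with a fixed value of $x+y$; a difference diagonal is a (nonempty) set of all cells with a fixed value of $x-y$. $\beta(Q_{n\times n})$ (the value of the Relaxed Queen's Domination Problem) is the least number $p$ such that there exist $p$ rows, $p$ columns, $p$ sum diagonals and $p$ difference diagonals (repetitions allowed) whose union is $V(Q_{n\times n})$; for $n=4k+3$ one has $\beta(Q_{n\times n})=2k+1$. A row, column or diagonal is ''chosen'' if it is one of the given $R_i$, $C_i$, $S_i$, $D_i$, and ''unchosen'' otherwise. The edge squares (edge cells) of $U$ are the cells $(x,y)\in U$ with $x\in\{l,r\}$ or $y\in\{b,t\}$. A line covers a cell if it contains it. *)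

(* Defs.v *)
From mathcomp Require Import all_boot.

Set Implicit Arguments.
Unset Strict Implicit.
Unset Printing Implicit Defensive.

(* A cell is (x, y): column number first, row number second. *)
Notation cell n := ('I_n * 'I_n)%type.

Definition row_line n (y : 'I_n) : {set cell n} := [set c : cell n | c.2 == y].
Definition col_line n (x : 'I_n) : {set cell n} := [set c : cell n | c.1 == x].

Definition same_sum n (c d : cell n) : bool := c.1 + c.2 == d.1 + d.2.

(* x - y = x' - y' as integers, with the subtractions moved across so that
   no truncation occurs. *)
Definition same_diff n (c d : cell n) : bool := c.1 + d.2 == d.1 + c.2.

(* Generating the diagonals from their cells keeps exactly the nonempty ones. *)
Definition sum_diags n : {set {set cell n}} :=
  [set [set d | same_sum c d] | c : cell n].
Definition diff_diags n : {set {set cell n}} :=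
  [set [set d | same_diff c d] | c : cell n].

Section Families.
Variables n p : nat.
Implicit Types (R C F : {ffun 'I_p -> 'I_n}) (S D : {ffun 'I_p -> {set cell n}}).

(* Rows and columns are given by their numbers, diagonals as sets of cells;
   repetitions are allowed in each family. *)
Definition is_solution R C S D : bool :=
  [&& [forall i, S i \in sum_diags n],
      [forall i, D i \in diff_diags n]
    & \bigcup_(i < p) (row_line (R i) :|: col_line (C i) :|: S i :|: D i)
        == [set: cell n]].

Definition cover_count R C S D (c : cell n) : nat :=
  #|[set i | c \in row_line (R i)]| + #|[set i | c \in col_line (C i)]|
  + #|[set i | c \in S i]| + #|[set i | c \in D i]|.

Definition first_unchosen F (x : 'I_n) : bool :=
  (x \notin codom F) && [forall z, (z \notin codom F) ==> (x <= z)].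
Definition last_unchosen F (x : 'I_n) : bool :=
  (x \notin codom F) && [forall z, (z \notin codom F) ==> (z <= x)].

End Families.

Definition relaxed_coverable (n p : nat) : bool :=
  [exists R : {ffun 'I_p -> 'I_n}, exists C : {ffun 'I_p -> 'I_n},
   exists S : {ffun 'I_p -> {set cell n}}, exists D : {ffun 'I_p -> {set cell n}},
     is_solution R C S D].

Lemma relaxed_coverable_ex n : exists p, relaxed_coverable n p.
Proof.
exists n; pose f : {ffun 'I_n -> 'I_n} := [ffun i => i].
apply/existsP; exists f; apply/existsP; exists f.
apply/existsP; exists [ffun i => [set d | same_sum (i, i) d]].
apply/existsP; exists [ffun i => [set d | same_diff (i, i) d]].
apply/and3P; split.
- by apply/forallP => i; rewrite ffunE; apply/imsetP; exists (i, i).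
- by apply/forallP => i; rewrite ffunE; apply/imsetP; exists (i, i).
apply/eqP/setP => c; rewrite inE; apply/bigcupP; exists c.1 => //.
by rewrite !inE ffunE eqxx orbT.
Qed.

Definition beta (n : nat) : nat := ex_minn (relaxed_coverable_ex n).

Definition subboard n (l r b t : 'I_n) : {set cell n} :=
  [set c : cell n | (l <= c.1 <= r) && (b <= c.2 <= t)].
Definition edge_cells n (l r b t : 'I_n) : {set cell n} :=
  [set c in subboard l r b t |
    [|| c.1 == l, c.1 == r, c.2 == b | c.2 == t]].

(* Meant for nonempty sum diagonals: x + y is constant on each of them and
   grows upwards. *)
Definition sum_above n (L M : {set cell n}) : bool :=
  [forall c in L, forall d in M, d.1 + d.2 < c.1 + c.2].

(* Meant for nonempty difference diagonals: x - y is constant on each of them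
   and decreases upwards; the inequality says c.1 - c.2 < d.1 - d.2. *)
Definition diff_above n (L M : {set cell n}) : bool :=
  [forall c in L, forall d in M, c.1 + d.2 < d.1 + c.2].

(* Main.v *)
Require Import Defs.
From mathcomp Require Import all_boot.
From mathcomp Require Import zify.

Set Implicit Arguments.
Unset Strict Implicit.
Unset Printing Implicit Defensive.

(** The proof is a double count of incidences between the chosen diagonals and
    the edge of [U].

    Write [n = 4k + 3].  A cell in an unchosen column and an unchosen row is
    called open; every open cell lies on a chosen diagonal.  Each of the
    columns [l] and [r] contains one open edge cell per unchosen row, and each
    of the rows [b] and [t] one per unchosen column; all four corners are open
    and counted twice.  There are at least [n - p] unchosen rows and at least
    [n - p] unchosen columns, so the edge has at least [4(n - p) - 4] open
    cells.  On the other hand a diagonal meets the edge of a rectangle in at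
    most two cells, so the [2p] chosen diagonals make at most [4p] incidences
    with the edge.  An explicit cover ([beta_4k3_le]) gives [p <= 2k + 1], and
    for such [p] the two bounds leave no room: [4(n - p) - 4 >= 4p].  Hence
    all the estimates are equalities ([tight_count]).  No row or column is
    repeated, every diagonal meets the edge exactly twice, open edge cells lie
    on exactly one diagonal and the other edge cells on none.  This gives (a),
    (c) and (d), and it shows that each side of [U] has [2k + 2] diagonal
    incidences.

    For (b), compare the incidences on the top and bottom sides with those on
    the left and right sides: by the above, both totals are [4k + 4].  If [U]
    were wider than tall, every diagonal that meets the edge twice would meet
    the horizontal sides at least as often as the vertical ones, and the sum
    diagonal through the corner [(l, t)] strictly more often, since its second
    edge cell would be a non-corner cell of the bottom side.  So the totals
    would differ.  A taller [U] is excluded in the same way ([square]).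

    For (e), no difference diagonal through [(l, t)] can be chosen, as it meets
    the edge only once.  So the sum diagonal through [(l, t)] is chosen, and
    because [U] is a square it passes through [(r, b)].  A sum diagonal above
    it meets the top and right sides once each, one below it the left and
    bottom sides; a difference diagonal meets the left side exactly when it
    meets the top side.  Equal totals on the left and top sides therefore force
    as many sum diagonals below the corner diagonal as above it, and the left
    and bottom sides do the same for the difference diagonals
    ([diagonals_balanced]). *)

(** * Counting by sums of indicators *)

Lemma card_sum_mem (I : finType) (A : {pred I}) : #|A| = \sum_i (i \in A).
Proof. by rewrite -sum1_card big_mkcond. Qed.

Lemma card_meet (T : finType) (A B : {set T}) :
  #|A :&: B| = \sum_(c in B) (c \in A).
Proof.
rewrite card_sum_mem [RHS]big_mkcond; apply: eq_bigr => c _.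
by rewrite inE andbC; case: (c \in B).
Qed.

Lemma sum_eq1 p (i0 : 'I_p) : \sum_i (i == i0) = 1.
Proof. by rewrite -(card1 i0) card_sum_mem; apply: eq_bigr. Qed.

(** An injective family takes the value [f i0] only at [i0], so weak and strict
    comparison with [f i0] differ by one index. *)
Lemma count_le_split p (f : 'I_p -> nat) i0 : injective f ->
  [/\ \sum_i (f i <= f i0) = \sum_i (f i < f i0) + 1,
      \sum_i (f i0 <= f i) = \sum_i (f i0 < f i) + 1
    & \sum_i (f i < f i0) + \sum_i (f i0 < f i) + 1 = p].
Proof.
move=> injf; rewrite -(sum_eq1 i0) -!big_split /=.
split; first by apply: eq_bigr => i _; rewrite -(inj_eq injf); case: ltngtP.
  by apply: eq_bigr => i _; rewrite -(inj_eq injf); case: ltngtP.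
rewrite -[RHS]card_ord -sum1_card.
by apply: eq_bigr => i _; rewrite -(inj_eq injf); case: ltngtP.
Qed.

Section Incidences.
Variables (T : finType) (p : nat) (A : 'I_p -> {set T}).

Lemma card_through c : #|[set i | c \in A i]| = \sum_i (c \in A i).
Proof. by rewrite card_sum_mem; apply: eq_bigr => i _; rewrite inE. Qed.

Lemma double_count (I : finType) (P : pred I) (g : I -> T) :
  \sum_(z | P z) #|[set i | g z \in A i]|
  = \sum_i \sum_(z | P z) (g z \in A i).
Proof.
by rewrite exchange_big; apply: eq_bigr => z _; rewrite card_through.
Qed.

(** Two equal members would both contain a point of [E], and [E] meets every
    member. *)
Lemma family_inj (E : {set T}) :
  (forall c, c \in E -> #|[set i | c \in A i]| <= 1) ->
  (forall i, #|A i :&: E| = 2) -> injective A.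
Proof.
move=> once twice i j eqA.
have /card_gt0P[c] : 0 < #|A i :&: E| by rewrite twice.
rewrite inE => /andP[cA cE].
by apply: (card_le1_eqP (once c cE)); rewrite inE // -?eqA.
Qed.
End Incidences.

(** * An upper bound for the number of lines *)

(** In coordinates centred on the middle of the board, take the even columns
    and rows and the diagonals with even [x + y] or even [x - y] in
    [[-2k, 2k]].  A cell off these rows and columns has odd centred coordinates
    of absolute value at most [2k + 1].  The smaller of [|x + y|] and [|x - y|]
    is then [||x| - |y||], which is even and at most [2k], so one of its two
    diagonals was taken. *)
Lemma relaxed_coverable_4k3 k : relaxed_coverable (4 * k + 3) (2 * k + 1).
Proof.
have lt_odd (i : 'I_(2 * k + 1)) : 2 * i + 1 < 4 * k + 3 by have := ltn_ord i; lia.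
have lt_sum (i : 'I_(2 * k + 1)) : k + 1 + i < 4 * k + 3 by have := ltn_ord i; lia.
have lt_d1 (i : 'I_(2 * k + 1)) : i < 4 * k + 3 by have := ltn_ord i; lia.
have lt_d2 (i : 'I_(2 * k + 1)) : 2 * k - i < 4 * k + 3 by have := ltn_ord i; lia.
pose odd_line := [ffun i => Ordinal (lt_odd i)].
pose s_cell i : cell _ := (Ordinal (lt_sum i), Ordinal (lt_sum i)).
pose d_cell i : cell _ := (Ordinal (lt_d1 i), Ordinal (lt_d2 i)).
apply/existsP; exists odd_line; apply/existsP; exists odd_line.
apply/existsP; exists [ffun i => [set d | same_sum (s_cell i) d]].
apply/existsP; exists [ffun i => [set d | same_diff (d_cell i) d]].
apply/and3P; split.
- by apply/forallP => i; rewrite ffunE; apply/imsetP; exists (s_cell i).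
- by apply/forallP => i; rewrite ffunE; apply/imsetP; exists (d_cell i).
apply/eqP/setP => -[x y]; rewrite [RHS]inE; apply/bigcupP.
have covered m : m < 2 * k + 1 ->
  [|| y == 2 * m + 1 :> nat, x == 2 * m + 1 :> nat,
      x + y == 2 * (k + 1 + m) | x + 2 * k == 2 * m + y] ->
  exists2 i : 'I_(2 * k + 1), true & (x, y) \in
    row_line (odd_line i) :|: col_line (odd_line i)
    :|: [ffun i => [set d | same_sum (s_cell i) d]] i
    :|: [ffun i => [set d | same_diff (d_cell i) d]] i.
  move=> lt_m hm; exists (Ordinal lt_m) => //.
  rewrite !inE !ffunE !inE /same_sum /same_diff -!val_eqE /=.
  by case/or4P: hm => /eqP hm; apply/orP; lia.
have := ltn_ord x; have := ltn_ord y => ly lx.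
have [oy|ey] := boolP (odd y); first by apply: (covered (y./2)); lia.
have [ox|ex] := boolP (odd x); first by apply: (covered (x./2)); lia.
have [hs|hs] := boolP (2 * k + 2 <= x + y <= 6 * k + 2).
  by apply: (covered ((x + y)./2 - (k + 1))); lia.
by apply: (covered ((x + 2 * k - y)./2)); lia.
Qed.

Lemma beta_4k3_le k : beta (4 * k + 3) <= 2 * k + 1.
Proof.
by rewrite /beta; case: ex_minnP => m _; apply; apply: relaxed_coverable_4k3.
Qed.

(** * Sums along the sides of a rectangle *)

(** Membership of the cells of a side in a diagonal always has the form
    [u + z == v], with [z] the running coordinate, so this sum counts the cells
    where a diagonal meets a side. *)
Lemma sum_interval_line n (b t : 'I_n) (u v : nat) :
  \sum_(z : 'I_n | b <= z <= t) (u + z == v) = (u + b <= v <= u + t).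
Proof.
have [/andP[hb ht]|out] := boolP (_ <= v <= _); last first.
  by apply: big1 => z hz; case: eqP => // hv; move: out; rewrite -hv; lia.
have hv : v - u < n by have := ltn_ord t; lia.
rewrite (bigD1 (Ordinal hv)) /=; last by lia.
rewrite subnKC; last by lia.
rewrite eqxx big1 // => z /andP[_]; rewrite -val_eqE /= => hz.
by case: eqP => // ?; lia.
Qed.

Section Perimeter.
Variables (n : nat) (l r b t : 'I_n).
Hypotheses (lt_lr : l < r) (lt_bt : b < t).
Implicit Types f : cell n -> nat.

Definition vsum f (x : 'I_n) := \sum_(z : 'I_n | b <= z <= t) f (x, z).
Definition hsum f (y : 'I_n) := \sum_(z : 'I_n | l <= z <= r) f (z, y).

Lemma vsumE f x :
  vsum f x = \sum_(c : cell n) ((c.1 == x) && (b <= c.2 <= t)) * f c.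
Proof.
transitivity (\sum_(x' : 'I_n) \sum_(z : 'I_n)
                ((x' == x) && (b <= z <= t)) * f (x', z)); last first.
  by rewrite pair_bigA; apply: eq_bigr => -[].
rewrite (bigD1 x) //= eqxx [X in _ = _ + X]big1 => [|x' /negPf ne]; last first.
  by apply: big1 => z _; rewrite ne mul0n.
rewrite addn0 /vsum big_mkcond; apply: eq_bigr => z _.
by case: ifP; rewrite ?mul1n ?mul0n.
Qed.

Lemma hsumE f y :
  hsum f y = \sum_(c : cell n) ((c.2 == y) && (l <= c.1 <= r)) * f c.
Proof.
transitivity (\sum_(y' : 'I_n) \sum_(z : 'I_n)
                ((y' == y) && (l <= z <= r)) * f (z, y')); last first.
  by rewrite exchange_big pair_bigA; apply: eq_bigr => -[].
rewrite (bigD1 y) //= eqxx.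
rewrite [X in _ = _ + X]big1 => [|y' /negPf ne]; last first.
  by apply: big1 => z _; rewrite ne mul0n.
rewrite addn0 /hsum big_mkcond; apply: eq_bigr => z _.
by case: ifP; rewrite ?mul1n ?mul0n.
Qed.

Lemma sum_cell1 f c0 : f c0 = \sum_(c : cell n) (c == c0) * f c.
Proof.
rewrite (bigD1 c0) //= eqxx mul1n big1 ?addn0 // => c /negPf ->.
by rewrite mul0n.
Qed.

(** The edge is the union of the four sides, which overlap in the corners only.
    Applied to indicator functions this yields the number of open edge cells
    and the number of edge cells on a given diagonal. *)
Lemma perimeter_sum f :
  \sum_(c in edge_cells l r b t) f c
    + (f (l, b) + f (l, t) + f (r, b) + f (r, t))
  = vsum f l + vsum f r + hsum f b + hsum f t.
Proof.
rewrite !vsumE !hsumE (sum_cell1 f (l, b)) (sum_cell1 f (l, t)).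
rewrite (sum_cell1 f (r, b)) (sum_cell1 f (r, t)) big_mkcond -!big_split /=.
apply: eq_bigr => -[x y] _; rewrite !inE /= !xpair_eqE -!val_eqE /=.
rewrite -[X in X + _ = _]mulnbl -!mulnDl; congr (_ * _).
have side m1 m2 z : m1 < m2 ->
    [&& (z == m1) ==> (m1 <= z <= m2), (z == m2) ==> (m1 <= z <= m2)
      & ~~ ((z == m1) && (z == m2))] by move=> ?; lia.
have := side _ _ x lt_lr; have := side _ _ y lt_bt.
by case: (_ <= x <= _); case: (_ <= y <= _); case: (_ == l :> nat);
  case: (_ == r :> nat); case: (_ == b :> nat); case: (_ == t :> nat).
Qed.
End Perimeter.

(** * Diagonals meeting the edge of a rectangle *)

Section DiagonalsOnEdge.
Variables (n : nat) (l r b t : 'I_n).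
Hypotheses (lt_lr : l < r) (lt_bt : b < t).
Implicit Types (A : {set cell n}) (s d : nat).

(** A diagonal is handled through its equation.  The number [d] of a difference
    diagonal is [x - y + n], which is a natural number on the whole board. *)
Definition has_sum A s := forall x y : 'I_n, ((x, y) \in A) = (x + y == s).
Definition has_diff A d := forall x y : 'I_n, ((x, y) \in A) = (x + n == y + d).

Lemma vsum_sum_diag A s x : has_sum A s ->
  vsum b t (fun c => c \in A) x = (x + b <= s <= x + t).
Proof.
by move=> hA; rewrite -sum_interval_line; apply: eq_bigr => z _; rewrite hA.
Qed.

Lemma hsum_sum_diag A s y : has_sum A s ->
  hsum l r (fun c => c \in A) y = (y + l <= s <= y + r).
Proof.
move=> hA; rewrite -sum_interval_line.
by apply: eq_bigr => z _; rewrite hA addnC.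
Qed.

Lemma vsum_diff_diag A d x : has_diff A d ->
  vsum b t (fun c => c \in A) x = (d + b <= x + n <= d + t).
Proof.
move=> hA; rewrite -sum_interval_line.
by apply: eq_bigr => z _; rewrite hA eq_sym addnC.
Qed.

Lemma hsum_diff_diag A d y : has_diff A d ->
  hsum l r (fun c => c \in A) y = (n + l <= y + d <= n + r).
Proof.
move=> hA; rewrite -sum_interval_line.
by apply: eq_bigr => z _; rewrite hA addnC.
Qed.

(** The diagonals that meet the rectangle only at [(l, b)] or only at [(r, t)]
    meet its edge once, which is why two edge cells force strict inequalities.
    The position of [s] with respect to the four corner values decides every
    indicator in the perimeter formula. *)
Lemma sum_diag_edge A s : has_sum A s ->
  #|A :&: edge_cells l r b t| <= 2 /\
  (#|A :&: edge_cells l r b t| = 2 -> l + b < s < r + t).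
Proof.
move=> hA; have := perimeter_sum lt_lr lt_bt (fun c => c \in A).
rewrite -card_meet !(vsum_sum_diag _ hA) !(hsum_sum_diag _ hA) !hA.
move: #|_| => e.
case: (ltngtP s (l + b)) => ?; case: (ltngtP s (l + t)) => ?;
  case: (ltngtP s (r + b)) => ?; case: (ltngtP s (r + t)) => ?; lia.
Qed.

Lemma diff_diag_edge A d : has_diff A d ->
  #|A :&: edge_cells l r b t| <= 2 /\
  (#|A :&: edge_cells l r b t| = 2 -> l + n < t + d /\ b + d < r + n).
Proof.
move=> hA; have := perimeter_sum lt_lr lt_bt (fun c => c \in A).
rewrite -card_meet !(vsum_diff_diag _ hA) !(hsum_diff_diag _ hA) !hA.
move: #|_| => e.
case: (ltngtP (l + n) (b + d)) => ?; case: (ltngtP (l + n) (t + d)) => ?;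
  case: (ltngtP (r + n) (b + d)) => ?; case: (ltngtP (r + n) (t + d)) => ?; lia.
Qed.
End DiagonalsOnEdge.

(** In a rectangle that is wider than tall, a sum diagonal meeting the edge
    twice meets the bottom and top sides, or a vertical and a horizontal side.
    Through the corners [(l, t)] and [(r, b)] it has one incidence with the
    vertical sides and two with the horizontal ones.  Exchanging the roles of
    columns and rows gives the statement for rectangles taller than wide, and
    that is where the second corner term is needed. *)
Lemma sum_diag_wide (l r b t s : nat) :
  l < r -> b < t -> l + t < r + b -> l + b < s < r + t ->
  (l + b <= s <= l + t) + (r + b <= s <= r + t) + (s == l + t) + (s == r + b)
  <= (b + l <= s <= b + r) + (t + l <= s <= t + r).
Proof.
rewrite ![b + _]addnC ![t + _]addnC => ? ? ? ?.
by case: (ltngtP s (l + t)) => ?; case: (ltngtP s (r + b)) => ?; lia.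
Qed.

(** The equation [x + u = y + v] is kept symmetric in the two coordinates, so
    that this inequality can also be used with columns and rows exchanged. *)
Lemma diff_diag_wide (l r b t u v : nat) :
  l < r -> b < t -> l + t < r + b -> l + u < t + v -> b + v < r + u ->
  (b + v <= l + u <= t + v) + (b + v <= r + u <= t + v)
  <= (l + u <= b + v <= r + u) + (l + u <= t + v <= r + u).
Proof.
move=> *.
by case: (ltngtP (l + u) (b + v)) => ?; case: (ltngtP (r + u) (t + v)) => ?; lia.
Qed.

(** * Unchosen rows and columns *)

Section UnchosenNumbers.
Variables n p : nat.
Implicit Types F : {ffun 'I_p -> 'I_n}.

Definition unchosen F : {set 'I_n} := [set x | x \notin codom F].

Lemma card_unchosen F : #|unchosen F| = n - #|codom F|.
Proof.
have := cardC (mem (codom F)); rewrite card_ord.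
suff -> : #|[predC codom F]| = #|unchosen F|.
  by move/(congr1 (subn^~ #|codom F|)); rewrite /= addKn.
by apply: eq_card => x; rewrite !inE.
Qed.

Lemma card_codom_le F : #|codom F| <= p.
Proof. by rewrite -[X in _ <= X]card_ord; apply: leq_image_card. Qed.

Lemma card_unchosen_ge F : n - p <= #|unchosen F|.
Proof. by rewrite card_unchosen leq_sub2l ?card_codom_le. Qed.

Lemma unchosen_inj F : p <= n -> #|unchosen F| = n - p -> injective F.
Proof.
rewrite card_unchosen => le_pn eq_card.
have le_cn : #|codom F| <= n.
  by rewrite -[X in _ <= X]card_ord; apply: max_card.
suff /image_injP inj : #|codom F| == #|'I_p| by move=> i j; apply: inj.
by rewrite card_ord; apply/eqP; have := card_codom_le F; lia.
Qed.

Lemma unchosen_span F (x1 x2 : 'I_n) :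
  first_unchosen F x1 -> last_unchosen F x2 ->
  forall z, z \notin codom F -> x1 <= z <= x2.
Proof.
move=> /andP[_ /forallP h1] /andP[_ /forallP h2] z hz.
by have := h1 z; have := h2 z; rewrite hz /= => -> ->.
Qed.

Lemma unchosen_ends_lt F (x1 x2 : 'I_n) : 1 < n - p ->
  first_unchosen F x1 -> last_unchosen F x2 -> x1 < x2.
Proof.
move=> lt1 h1 h2; rewrite ltnNge; apply/negP => le21.
have := leq_trans lt1 (card_unchosen_ge F); rewrite ltnNge => /negP; apply.
apply/card_le1_eqP => x y; rewrite !inE => hx hy; apply: val_inj => /=.
have := unchosen_span h1 h2 hx; have := unchosen_span h1 h2 hy.
by lia.
Qed.

Lemma sum_unchosen F (x1 x2 : 'I_n) :
  first_unchosen F x1 -> last_unchosen F x2 ->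
  \sum_(z : 'I_n | x1 <= z <= x2) (z \notin codom F) = #|unchosen F|.
Proof.
move=> h1 h2; rewrite card_sum_mem big_mkcond; apply: eq_bigr => z _.
rewrite inE; case: ifP => // out; case: (boolP (z \notin _)) => // hz.
by rewrite (unchosen_span h1 h2 hz) in out.
Qed.

Lemma card_fiber F x : injective F -> #|[set i | x == F i]| = (x \in codom F).
Proof.
move=> injF; case: (boolP (x \in codom F)) => [/codomP[i ->]|hx].
  rewrite (_ : [set _ | _] = [set i]) ?cards1 //.
  by apply/setP => j; rewrite !inE (inj_eq injF) eq_sym.
apply/eqP; rewrite cards_eq0; apply/eqP/setP => j; rewrite !inE.
by apply/negP => /eqP hj; rewrite hj codom_f in hx.
Qed.
End UnchosenNumbers.

(** * The double count on the edge *)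

Section TightCount.
Variables (k n p : nat) (R C : {ffun 'I_p -> 'I_n}).
Variables (S D : {ffun 'I_p -> {set cell n}}) (s d : 'I_p -> nat).
Variables (l r b t : 'I_n).
Hypotheses (hn : n = 4 * k + 3) (hp : p <= 2 * k + 1).
Hypotheses (hS : forall i, has_sum (S i) (s i)).
Hypotheses (hD : forall i, has_diff (D i) (d i)).
Hypotheses (hl : first_unchosen C l) (hr : last_unchosen C r).
Hypotheses (hb : first_unchosen R b) (ht : last_unchosen R t).

Local Notation E := (edge_cells l r b t).

Definition ndiag c := #|[set i | c \in S i]| + #|[set i | c \in D i]|.
Definition open_cell (c : cell n) := (c.1 \notin codom C) && (c.2 \notin codom R).

Hypothesis cov : forall c, open_cell c -> 0 < ndiag c.

Let lC : l \notin codom C. Proof. by case/andP: hl. Qed.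
Let rC : r \notin codom C. Proof. by case/andP: hr. Qed.
Let bR : b \notin codom R. Proof. by case/andP: hb. Qed.
Let tR : t \notin codom R. Proof. by case/andP: ht. Qed.

Lemma lt_lr : l < r.
Proof. by apply: (unchosen_ends_lt _ hl hr); clear -hn hp; lia. Qed.

Lemma lt_bt : b < t.
Proof. by apply: (unchosen_ends_lt _ hb ht); clear -hn hp; lia. Qed.

Lemma vsum_open x : x \notin codom C -> vsum b t open_cell x = #|unchosen R|.
Proof.
move=> hx; rewrite -(sum_unchosen hb ht).
by apply: eq_bigr => z _; rewrite /open_cell hx.
Qed.

Lemma hsum_open y : y \notin codom R -> hsum l r open_cell y = #|unchosen C|.
Proof.
move=> hy; rewrite -(sum_unchosen hl hr).
by apply: eq_bigr => z _; rewrite /open_cell hy andbT.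
Qed.

(** Each corner is open and lies on two sides, whence the 4. *)
Lemma sum_open_edge :
  \sum_(c in E) open_cell c + 4 = 2 * #|unchosen R| + 2 * #|unchosen C|.
Proof.
have := perimeter_sum lt_lr lt_bt open_cell.
rewrite !vsum_open // !hsum_open // /open_cell /= lC rC bR tR /=.
by clear; lia.
Qed.

Lemma sum_ndiag_edge :
  \sum_(c in E) ndiag c = \sum_i (#|S i :&: E| + #|D i :&: E|).
Proof.
rewrite !big_split /= (double_count S _ id) (double_count D _ id).
by congr (_ + _); apply: eq_bigr => i _; rewrite card_meet.
Qed.

(** The incidences between diagonals and edge number at most [4p], and at least
    [4(n - p) - 4] by the count of open edge cells.  As [4(n - p) - 4 >= 4p],
    both bounds are attained, and equality of the sums gives equality of each
    pair of terms. *)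
Lemma tight_count :
  [/\ p = 2 * k + 1, #|unchosen C| = n - p, #|unchosen R| = n - p,
      forall i, #|S i :&: E| = 2 /\ #|D i :&: E| = 2
    & forall c, c \in E -> ndiag c = open_cell c].
Proof.
have arith U V x y : U <= p * 4 -> V <= U -> V + 4 = 2 * x + 2 * y ->
    n - p <= x -> n - p <= y ->
    [/\ p = 2 * k + 1, y = n - p, x = n - p, U = p * 4 & V = U].
  by clear -hn hp; move=> *; split; lia.
have le2 i : true -> #|S i :&: E| + #|D i :&: E| <= 4
                 ?= iff (#|S i :&: E| + #|D i :&: E| == 4).
  move=> _; split=> //.
  have [leS _] := sum_diag_edge lt_lr lt_bt (hS i).
  by have [leD _] := diff_diag_edge lt_lr lt_bt (hD i); apply: (leq_add leS leD).
have [up eq_up] := leqif_sum le2.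
have le1 (c : cell n) : c \in E ->
    (open_cell c : nat) <= ndiag c ?= iff (open_cell c == ndiag c :> nat).
  by move=> _; split=> //; case: (boolP (open_cell c)) => // /cov.
have [low eq_low] := leqif_sum le1.
move: up low eq_up eq_low; rewrite sum_ndiag_edge sum_nat_const card_ord.
have := sum_open_edge; have := card_unchosen_ge C; have := card_unchosen_ge R.
move=> cR cC tot up low.
have [pE XE YE -> ->] := arith _ _ _ _ up low tot cR cC; rewrite !eqxx.
move=> /esym/forallP all4 /esym/forallP allE.
split=> // [i|c cE]; last by have /implyP/(_ cE)/eqP := allE c.
have [leS _] := sum_diag_edge lt_lr lt_bt (hS i).
have [leD _] := diff_diag_edge lt_lr lt_bt (hD i).
by have := all4 i; clear -leS leD => ?; split; lia.
Qed.


(** On the sides of [U] the open cells are those in unchosen rows (vertical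
    sides) or in unchosen columns (horizontal sides), so every side carries
    exactly [n - p = 2k + 2] incidences with diagonals. *)
Lemma vsum_tight x : x \in [:: l; r] ->
  \sum_i (x + b <= s i <= x + t) + \sum_i (d i + b <= x + n <= d i + t)
  = 2 * k + 2.
Proof.
move=> xlr; have [pE _ YE _ tight] := tight_count.
have xC : x \notin codom C by move: xlr; rewrite !inE => /pred2P[] ->.
transitivity (vsum b t ndiag x); last first.
  rewrite (_ : vsum _ _ _ _ = vsum b t open_cell x).
    by rewrite vsum_open // YE; clear -hn pE; lia.
  apply: eq_bigr => z hz; apply: tight; move: xlr; rewrite !inE.
  have := ltnW lt_lr; move: hz => /= -> /= le_lr /pred2P[] ->;
    by rewrite le_lr eqxx ?orbT /= leqnn.
rewrite /vsum big_split /= (double_count S _ (pair x))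
  (double_count D _ (pair x)).
congr (_ + _); apply: eq_bigr => i _.
  by apply: esym; apply: vsum_sum_diag.
by apply: esym; apply: vsum_diff_diag.
Qed.

Lemma hsum_tight y : y \in [:: b; t] ->
  \sum_i (y + l <= s i <= y + r) + \sum_i (n + l <= y + d i <= n + r)
  = 2 * k + 2.
Proof.
move=> ybt; have [pE XE _ _ tight] := tight_count.
have yR : y \notin codom R by move: ybt; rewrite !inE => /pred2P[] ->.
transitivity (hsum l r ndiag y); last first.
  rewrite (_ : hsum _ _ _ _ = hsum l r open_cell y).
    by rewrite hsum_open // XE; clear -hn pE; lia.
  apply: eq_bigr => z hz; apply: tight; move: ybt; rewrite !inE.
  have := ltnW lt_bt; move: hz => /= -> /= le_bt /pred2P[] ->;
    by rewrite le_bt eqxx ?orbT /= leqnn.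
rewrite /hsum big_split /= (double_count S _ (pair^~ y))
  (double_count D _ (pair^~ y)).
congr (_ + _); apply: eq_bigr => i _.
  by apply: esym; apply: hsum_sum_diag.
by apply: esym; apply: hsum_diff_diag.
Qed.

Lemma sum_diag_inside i : l + b < s i < r + t.
Proof.
have [_ _ _ /(_ i)[twice _] _] := tight_count.
by have [_] := sum_diag_edge lt_lr lt_bt (hS i); apply.
Qed.

Lemma diff_diag_inside i : l + n < t + d i /\ b + d i < r + n.
Proof.
have [_ _ _ /(_ i)[_ twice] _] := tight_count.
by have [_] := diff_diag_edge lt_lr lt_bt (hD i); apply.
Qed.

(** The corner is open, hence covered by a diagonal, and the difference diagonal
    through it meets the edge nowhere else. *)
Lemma corner_sum_diag : exists i, s i = l + t.
Proof.
have: 0 < ndiag (l, t) by apply: cov; rewrite /open_cell /= lC tR.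
rewrite addn_gt0 => /orP[] /card_gt0P[i]; rewrite inE ?hS ?hD => /eqP hi.
  by exists i.
by have [] := diff_diag_inside i; rewrite hi ltnn.
Qed.

Lemma corner_diff_diag : exists i, l + n = b + d i.
Proof.
have: 0 < ndiag (l, b) by apply: cov; rewrite /open_cell /= lC bR.
rewrite addn_gt0 => /orP[] /card_gt0P[i]; rewrite inE ?hS ?hD => /eqP hi.
  by have := sum_diag_inside i; rewrite -hi ltnn.
by exists i.
Qed.

(** The incidences of the diagonals with the two horizontal sides and with the
    two vertical sides have the same total, which fails for a rectangle that is
    not a square because the corner sum diagonal breaks the tie. *)
Lemma square : r - l = t - b.
Proof.
have [i0 hi0] := corner_sum_diag.
have [ll rr] : l \in [:: l; r] /\ r \in [:: l; r] by rewrite !inE !eqxx orbT.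
have [bb tt] : b \in [:: b; t] /\ t \in [:: b; t] by rewrite !inE !eqxx orbT.
have := vsum_tight ll; have := vsum_tight rr.
have := hsum_tight bb; have := hsum_tight tt.
move=> hT hB hR hL.
(* Unprimed letters stand for sum diagonals, primed ones for difference
   diagonals; [T], [B], [W], [L] are the incidences with the four sides. *)
have unbalanced T T' B B' W W' L L' m :
    T + T' = m -> B + B' = m -> W + W' = m -> L + L' = m ->
    L + W + 1 <= B + T -> L' + W' <= B' + T' -> False by clear; lia.
have le0 i : (i == i0) <= (s i == l + t).
  by case: eqVneq => // ->; rewrite hi0 eqxx.
have lt1 := lt_lr; have lt2 := lt_bt.
have [wide|tall|] := ltngtP (l + t) (r + b); last by clear -lt1 lt2; lia.
- have leS: \sum_i ((l + b <= s i <= l + t) + (r + b <= s i <= r + t) + (i == i0))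
        <= \sum_i ((b + l <= s i <= b + r) + (t + l <= s i <= t + r)).
    apply: leq_sum => i _.
    apply: leq_trans (sum_diag_wide _ _ _ (sum_diag_inside i)) => //.
    by rewrite -[X in _ <= X]addnA leq_add2l (leq_trans (le0 i)) ?leq_addr.
  have leD: \sum_i ((d i + b <= l + n <= d i + t) + (d i + b <= r + n <= d i + t))
        <= \sum_i ((n + l <= b + d i <= n + r) + (n + l <= t + d i <= n + r)).
    apply: leq_sum => i _; have [? ?] := diff_diag_inside i.
    by rewrite ![d i + _]addnC ![n + _]addnC; apply: diff_diag_wide.
  move: leS leD; rewrite !big_split /= sum_eq1 => leS leD.
  by case: (unbalanced _ _ _ _ _ _ _ _ _ hT hB hR hL leS leD).
- have leS: \sum_i ((b + l <= s i <= b + r) + (t + l <= s i <= t + r) + (i == i0))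
        <= \sum_i ((l + b <= s i <= l + t) + (r + b <= s i <= r + t)).
    apply: leq_sum => i _.
    have inside : b + l < s i < t + r by
      rewrite ![_ + l]addnC ![_ + r]addnC sum_diag_inside.
    apply: leq_trans (sum_diag_wide lt2 lt1 _ inside); last first.
      by rewrite ![_ + r]addnC ![_ + l]addnC.
    rewrite -[X in _ <= X]addnA leq_add2l (leq_trans (le0 i)) //.
    by rewrite [t + l]addnC leq_addl.
  have leD: \sum_i ((n + l <= b + d i <= n + r) + (n + l <= t + d i <= n + r))
        <= \sum_i ((d i + b <= l + n <= d i + t) + (d i + b <= r + n <= d i + t)).
    apply: leq_sum => i _; have [? ?] := diff_diag_inside i.
    rewrite ![d i + _]addnC ![n + _]addnC; apply: diff_diag_wide => //.
    by rewrite addnC [t + l]addnC.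
  move: leS leD; rewrite !big_split /= sum_eq1 => leS leD.
  by case: (unbalanced _ _ _ _ _ _ _ _ _ hR hL hT hB leS leD).
Qed.

Lemma once_edge c : c \in E ->
  #|[set i | c \in S i]| <= 1 /\ #|[set i | c \in D i]| <= 1.
Proof.
have [_ _ _ _ tight] := tight_count => /tight.
by rewrite /ndiag; case: (open_cell c); clear => /=; lia.
Qed.

Lemma sum_diags_inj : injective S.
Proof.
have [_ _ _ twice _] := tight_count.
by apply: (@family_inj _ _ _ E) => [c /once_edge[]//|i]; case: (twice i).
Qed.

Lemma diff_diags_inj : injective D.
Proof.
have [_ _ _ twice _] := tight_count.
by apply: (@family_inj _ _ _ E) => [c /once_edge[]//|i]; case: (twice i).
Qed.

Lemma sum_numbers_inj : injective s.
Proof.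
move=> i j eq_s; apply: sum_diags_inj; apply/setP => -[x y].
by rewrite !hS eq_s.
Qed.

Lemma diff_numbers_inj : injective d.
Proof.
move=> i j eq_d; apply: diff_diags_inj; apply/setP => -[x y].
by rewrite !hD eq_d.
Qed.

(** In a square, a sum diagonal meets the left or bottom side when it is not
    above the corner diagonal, and the top or right side when it is not below
    it.  A difference diagonal meets the left side if and only if it meets the
    top side.  So the totals of the left and top sides balance the sum
    diagonals, and those of the left and bottom sides the difference
    diagonals. *)
Lemma diagonals_balanced i0 j0 : s i0 = l + t -> l + n = b + d j0 ->
  [/\ \sum_i (s i < s i0) = k, \sum_i (s i0 < s i) = k,
      \sum_i (d i < d j0) = k & \sum_i (d j0 < d i) = k].
Proof.
move=> hi0 hj0; have [pE _ _ _ _] := tight_count.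
have ll : l \in [:: l; r] by rewrite !inE eqxx.
have [bb tt] : b \in [:: b; t] /\ t \in [:: b; t] by rewrite !inE !eqxx orbT.
have sq : l + t = r + b.
  by move: square lt_lr lt_bt; clear; lia.
have := vsum_tight ll; have := hsum_tight bb; have := hsum_tight tt.
rewrite [\sum_i (t + l <= _ <= _)](_ : _ = \sum_i (s i0 <= s i)); last first.
  by apply: eq_bigr => i _; move: (sum_diag_inside i); rewrite hi0;
    clear -sq => ?; congr (nat_of_bool _); lia.
rewrite [\sum_i (b + l <= _ <= _)](_ : _ = \sum_i (s i <= s i0)); last first.
  by apply: eq_bigr => i _; move: (sum_diag_inside i); rewrite hi0;
    clear -sq => ?; congr (nat_of_bool _); lia.
rewrite [\sum_i (l + b <= _ <= _)](_ : _ = \sum_i (s i <= s i0)); last first.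
  by apply: eq_bigr => i _; move: (sum_diag_inside i); rewrite hi0;
    clear -sq => ?; congr (nat_of_bool _); lia.
rewrite [\sum_i (n + l <= t + _ <= _)](_ : _ = \sum_i (d i <= d j0)); last first.
  by apply: eq_bigr => i _; move: (diff_diag_inside i);
    clear -sq hj0 => -[? ?]; congr (nat_of_bool _); lia.
rewrite [\sum_i (n + l <= b + _ <= _)](_ : _ = \sum_i (d j0 <= d i)); last first.
  by apply: eq_bigr => i _; move: (diff_diag_inside i);
    clear -sq hj0 => -[? ?]; congr (nat_of_bool _); lia.
rewrite [\sum_i (_ + b <= _ <= _)](_ : _ = \sum_i (d i <= d j0)); last first.
  by apply: eq_bigr => i _; move: (diff_diag_inside i);
    clear -sq hj0 => -[? ?]; congr (nat_of_bool _); lia.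
have [-> -> s3] := count_le_split i0 sum_numbers_inj.
have [-> -> d3] := count_le_split j0 diff_numbers_inj.
by move: s3 d3; clear -pE => *; split; lia.
Qed.
End TightCount.

(** * Diagonals as sets of cells, and the theorem *)

Lemma sum_diagP n (A : {set cell n}) : A \in sum_diags n ->
  exists s, has_sum A s.
Proof.
case/imsetP=> -[x0 y0] _ ->; exists (x0 + y0) => x y.
by rewrite inE /same_sum /= eq_sym.
Qed.

Lemma diff_diagP n (A : {set cell n}) : A \in diff_diags n ->
  exists d, has_diff A d.
Proof.
case/imsetP=> -[x0 y0] _ ->; exists (x0 + n - y0) => x y.
by rewrite inE /same_diff /=; have := ltn_ord y0; lia.
Qed.

Lemma sum_aboveE n (A B : {set cell n}) sA sB :
  has_sum A sA -> has_sum B sB -> A != set0 -> B != set0 ->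
  sum_above A B = (sB < sA).
Proof.
move=> hA hB /set0Pn[[x y] cA] /set0Pn[[x' y'] cB].
apply/idP/idP => [/forall_inP/(_ _ cA)/forall_inP/(_ _ cB) /=|lt_BA].
  by move: cA cB; rewrite hA hB => /eqP -> /eqP ->.
apply/forall_inP => -[u v]; rewrite hA => /eqP uv.
by apply/forall_inP => -[u' v']; rewrite hB => /eqP uv' /=; rewrite uv uv'.
Qed.

Lemma diff_aboveE n (A B : {set cell n}) dA dB :
  has_diff A dA -> has_diff B dB -> A != set0 -> B != set0 ->
  diff_above A B = (dA < dB).
Proof.
move=> hA hB /set0Pn[[x y] cA] /set0Pn[[x' y'] cB].
apply/idP/idP => [/forall_inP/(_ _ cA)/forall_inP/(_ _ cB) /=|lt_AB].
  by move: cA cB; rewrite hA hB; clear; lia.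
apply/forall_inP => -[u v]; rewrite hA => /eqP uv.
apply/forall_inP => -[u' v']; rewrite hB => /eqP uv' /=.
by clear -uv uv' lt_AB; lia.
Qed.

Theorem theorem5p5 (k n p : nat) (hn : n = 4 * k + 3) (hp : p = beta n)
  (R C : {ffun 'I_p -> 'I_n}) (S D : {ffun 'I_p -> {set cell n}})
  (hsol : is_solution R C S D)
  (l r b t : 'I_n)
  (hl : first_unchosen C l) (hr : last_unchosen C r)
  (hb : first_unchosen R b) (ht : last_unchosen R t) :
  (* (a) *)
  [/\ injective R, injective C, injective S & injective D] /\
  (* (b) *)
  (r - l = t - b) /\
  (* (c) *)
  (forall c : cell n, c \in edge_cells l r b t -> cover_count R C S D c = 1) /\
  (* (d) *)
  (forall i : 'I_p, #|S i :&: edge_cells l r b t| = 2 /\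
                    #|D i :&: edge_cells l r b t| = 2) /\
  (* (e) *)
  (exists i0 : 'I_p,
     [/\ ((l, t) : cell n) \in S i0, ((r, b) : cell n) \in S i0,
         #|[set i : 'I_p | i != i0]| = 2 * k,
         #|[set i : 'I_p | sum_above (S i) (S i0)]| = k
       & #|[set i : 'I_p | sum_above (S i0) (S i)]| = k]) /\
  (exists i0 : 'I_p,
     [/\ ((l, b) : cell n) \in D i0, ((r, t) : cell n) \in D i0,
         #|[set i : 'I_p | i != i0]| = 2 * k,
         #|[set i : 'I_p | diff_above (D i) (D i0)]| = k
       & #|[set i : 'I_p | diff_above (D i0) (D i)]| = k]).
Proof.
have le_p : p <= 2 * k + 1 by rewrite hp hn beta_4k3_le.
case/and3P: hsol => /forallP hS /forallP hD /eqP full.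
have [s has_s] := fin_all_exists (fun i => sum_diagP (hS i)).
have [d has_d] := fin_all_exists (fun i => diff_diagP (hD i)).
have cov c : open_cell R C c -> 0 < ndiag S D c.
  case/andP=> cC cR; have := in_setT c; rewrite -full => /bigcupP[i _].
  rewrite !inE addn_gt0 -!orbA.
  have -> : (c.2 == R i) = false by apply: contraNF cR => /eqP ->; apply: codom_f.
  have -> : (c.1 == C i) = false by apply: contraNF cC => /eqP ->; apply: codom_f.
  rewrite /= => /orP[] hi; apply/orP; [left|right]; apply/card_gt0P;
    by exists i; rewrite inE.
have [pE uC uR twice tight] := tight_count hn le_p has_s has_d hl hr hb ht cov.
have le_pn : p <= n by clear -hn le_p; lia.
have injR := unchosen_inj le_pn uR; have injC := unchosen_inj le_pn uC.
have injS := sum_diags_inj hn le_p has_s has_d hl hr hb ht cov.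
have injD := diff_diags_inj hn le_p has_s has_d hl hr hb ht cov.
have sq := square hn le_p has_s has_d hl hr hb ht cov.
have ltlr := lt_lr hn le_p hl hr; have ltbt := lt_bt hn le_p hb ht.
have S0 i : S i != set0.
  by apply/eqP => S0; have [] := twice i; rewrite S0 set0I cards0.
have D0 i : D i != set0.
  by apply/eqP => D0; have [_] := twice i; rewrite D0 set0I cards0.
have others (i0 : 'I_p) : #|[set i | i != i0]| = 2 * k.
  have <- : p.-1 = 2 * k by rewrite [in LHS]pE addn1.
  have := cardsC1 i0; rewrite card_ord => <-.
  by apply: eq_card => i; rewrite !inE.
have [i0 hi0] := corner_sum_diag hn le_p has_s has_d hl hr hb ht cov.
have [j0 hj0] := corner_diff_diag hn le_p has_s has_d hl hr hb ht cov.
have [s1 s2 d1 d2] :=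
  diagonals_balanced hn le_p has_s has_d hl hr hb ht cov hi0 hj0.
split; first by [].
split; first by [].
split=> [c cE|].
  have := tight c cE; rewrite /ndiag /cover_count -addnA => ->.
  have -> : #|[set i | c \in row_line (R i)]| = (c.2 \in codom R).
    by rewrite -card_fiber //; apply: eq_card => i; rewrite !inE.
  have -> : #|[set i | c \in col_line (C i)]| = (c.1 \in codom C).
    by rewrite -card_fiber //; apply: eq_card => i; rewrite !inE.
  (* An edge cell lies in an unchosen column or row, so at most one of the two
     codomain indicators is 1. *)
  have : (c.1 \notin codom C) || (c.2 \notin codom R).
    case/andP: hl => lC _; case/andP: hr => rC _.
    case/andP: hb => bR _; case/andP: ht => tR _.
    by move: cE; rewrite inE => /andP[_ /or4P[] /eqP ->];
      rewrite ?lC ?rC ?bR ?tR ?orbT.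
  by rewrite /open_cell; case: (c.1 \in _); case: (c.2 \in _).
split; first by [].
split; [exists i0|exists j0]; split; rewrite ?others //.
- by rewrite has_s hi0.
- by rewrite has_s hi0; clear -sq ltlr ltbt; lia.
- rewrite -[RHS]s2 card_sum_mem; apply: eq_bigr => i _.
  by rewrite inE (sum_aboveE (has_s i) (has_s i0)).
- rewrite -[RHS]s1 card_sum_mem; apply: eq_bigr => i _.
  by rewrite inE (sum_aboveE (has_s i0) (has_s i)).
- by rewrite has_d hj0.
- by rewrite has_d; clear -sq ltlr ltbt hj0; lia.
- rewrite -[RHS]d1 card_sum_mem; apply: eq_bigr => i _.
  by rewrite inE (diff_aboveE (has_d i) (has_d j0)).
- rewrite -[RHS]d2 card_sum_mem; apply: eq_bigr => i _.
  by rewrite inE (diff_aboveE (has_d j0) (has_d i)).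
Qed.
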